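(* Let $\mathcal{R}$ be a TRS that is well-typed with respect to an annotated signature $\mathcal{F}$. Let $\Gamma$ be a typing context, $t$ a term, $A$ an annotated type and $p$ a cost such that $\Gamma \vdash^{p} t : A$ is derivable, and let $\sigma$ be a substitution that is well-typed with respect to $\Gamma$. If $\sigma \vdash t \Downarrow^{m} v$ for a value $v$ and a natural number $m$, then $$\Phi(\sigma:\Gamma) - \Phi(v:A) + p \geqslant m .$$
   Context: Typed rewriting. $\mathcal{C}$ (constructors) and $\mathcal{D}$ (defined symbols) are disjoint finite sets of function symbols, $S$ is a finite set of base types, and $\mathcal{V}$ is an $S$-sorted set of variables. Every $f\in\mathcal{C}\cup\mathcal{D}$ has a base type declaration $A_1\times\cdots\times A_n\to C$ ($A_i,C\in S$), and terms are built respecting these declarations. Values are ground terms built only from constructors. Substitutions respect types; a substitution is normalised if all terms in its range are values, and all substitutions below are normalised. For substitutions with disjoint domains, $\sigma\uplus\tau$ denotes their union; $\sigma'$ extends $\sigma$ if $\sigma'$ restricted to $\mathrm{dom}(\sigma)$ equals $\sigma$. $\mathcal{R}$ is a finite set of typed rules $f(l_1,\dots,l_n)\to r$ with $f\in\mathcal{D}$, all $l_i$ built from constructors and variables, $l$ and $r$ of the same type and $\mathrm{Var}(r)\subseteq\mathrm{Var}(l)$. $\mathcal{R}$ is left-linear, non-overlapping and completely defined (every ground normal form is a value). Big-step semantics. Judgements $\sigma\vdash t\Downarrow^{m} v$ ($\sigma$ normalised, $v$ a value, $m\in\mathbb{N}$) are defined by the rules: (i) if $x\sigma=v$ then $\sigma\vdash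 x\Downarrow^{0} v$; (ii) if $c\in\mathcal{C}$ and $x_i\sigma=v_i$ for all $i$ then $\sigma\vdash c(x_1,\dots,x_n)\Downarrow^{0} c(v_1,\dots,v_n)$; (iii) if $f(l_1,\dots,l_n)\to r\in\mathcal{R}$, there is $\tau$ with $x_i\sigma=l_i\tau$ for all $i$, and $\sigma\uplus\tau\vdash r\Downarrow^{m} v$, then $\sigma\vdash f(x_1,\dots,x_n)\Downarrow^{m+1} v$; (iv) if $x_1,\dots,x_n$ are fresh variables, $\sigma\vdash t_i\Downarrow^{m_i} v_i$ for $i=1,\dots,n$, $\sigma\uplus\rho\vdash f(x_1,\dots,x_n)\Downarrow^{m_0} v$ with $\rho=\{x_1\mapsto v_1,\dots,x_n\mapsto v_n\}$, and $m=\sum_{i=0}^n m_i$, then $\sigma\vdash f(t_1,\dots,t_n)\Downarrow^{m} v$. Annotated types. A resource annotation is a finite vector $\vec p=(p_1,\dots,p_k)$ of non-negative rationals; $\leqslant$ and $+$ on annotations are componentwise after padding the shorter vector with zeros. An annotated type $A^{\vec p}$ is a base type $A$ with an annotation. An annotated signature $\mathcal{F}$ maps each $f$ with base declaration $A_1\times\cdots\times A_n\to C$ to a nonempty set of annotated declarations $A_1^{\vec u_1}\times\cdots\times A_n^{\vec u_n}\xrightarrow{p} C^{\vec v}$ ($p\geqslant 0$ a cost), such that for each annotation $\vec v$ there is exactly one declaration in $\mathcal{F}(f)$ with result type $C^{\vec v}$, and for constructors $c$, $\mathcal{F}(c)$ is closed under multiplying all annotations and the cost by any $\lambda\geqslant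 0$ and under componentwise addition of two declarations. The potential of a value $v=c(v_1,\dots,v_n)$ at annotated type $C$ is $\Phi(v:C)=p+\sum_i\Phi(v_i:A_i)$, where $A_1\times\cdots\times A_n\xrightarrow{p}C$ is the unique declaration of $c$ with result $C$. Sharing: $A^{\vec p}\curlyvee(A_1^{\vec p_1},A_2^{\vec p_2})$ iff $A=A_1=A_2$ and $\vec p_1+\vec p_2=\vec p$. Subtyping: $A^{\vec p}<:B^{\vec q}$ iff $A=B$ and $\vec p\geqslant\vec q$. Type system. A typing context maps finitely many variables to annotated types. Judgements $\Gamma\vdash^{p} t:C$ ($p\geqslant0$) are derived by: (1) if $f\in\mathcal{C}\cup\mathcal{D}$ and $A_1\times\cdots\times A_n\xrightarrow{p}C\in\mathcal{F}(f)$ then $x_1:A_1,\dots,x_n:A_n\vdash^{p} f(x_1,\dots,x_n):C$; (2) from $\Gamma\vdash^{p}t:C$ and $p'\geqslant p$ infer $\Gamma\vdash^{p'}t:C$; (3) if $x_1,\dots,x_n$ are fresh, $x_1:A_1,\dots,x_n:A_n\vdash^{p_0} f(x_1,\dots,x_n):C$, $\Gamma_i\vdash^{p_i}t_i:A_i$ for $i=1,\dots,n$ and $p=\sum_{i=0}^n p_i$, then $\Gamma_1,\dots,\Gamma_n\vdash^{p} f(t_1,\dots,t_n):C$; (4) from $\Gamma\vdash^{p}t:C$ infer $\Gamma,x:A\vdash^{p}t:C$; (5) from $\Gamma,x:A_1,y:A_2\vdash^{p}t[x,y]:C$ with $A\curlyvee(A_1,A_2)$ and $x,y$ fresh infer $\Gamma,z:A\vdash^{p}t[z,z]:C$;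 (6) from $\Gamma,x:B\vdash^{p}t:C$ and $A<:B$ infer $\Gamma,x:A\vdash^{p}t:C$; (7) $x:A\vdash^{0}x:A$; (8) from $\Gamma\vdash^{p}t:D$ and $D<:C$ infer $\Gamma\vdash^{p}t:C$. Well-typedness. A defined symbol $f$ is well-typed if for every rule $f(l_1,\dots,l_n)\to r\in\mathcal{R}$ with $\mathrm{Var}(f(l_1,\dots,l_n))=\{y_1,\dots,y_\ell\}$, every declaration $A_1\times\cdots\times A_n\xrightarrow{p}C\in\mathcal{F}(f)$, all annotated types $B_1,\dots,B_\ell$ and all costs $k_1,\dots,k_n$ such that $y_1:B_1,\dots,y_\ell:B_\ell\vdash^{k_i} l_i:A_i$ is derivable for each $i$, the judgement $y_1:B_1,\dots,y_\ell:B_\ell\vdash^{p-1+\sum_{i=1}^n k_i} r:C$ is derivable. $\mathcal{R}$ is well-typed if every defined symbol is. A substitution $\sigma$ is well-typed with respect to $\Gamma$ if for every $x\in\mathrm{dom}(\Gamma)$, $x\sigma$ is a value of the (base) type of $\Gamma(x)$; then $\Phi(\sigma:\Gamma)=\sum_{x\in\mathrm{dom}(\Gamma)}\Phi(x\sigma:\Gamma(x))$. *)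

(* Defs.v *)
From Stdlib Require List.
From HB Require Import structures.
From mathcomp Require Import all_boot all_order all_algebra.
From mathcomp Require Import finmap interval_inference.
From mathcomp Require Import boolp classical_sets cardinality.

Set Implicit Arguments.
Unset Strict Implicit.
Unset Printing Implicit Defensive.

Import Order.TTheory GRing.Theory Num.Theory.
Local Open Scope ring_scope.

(* Constructors and defined symbols are disjoint because function symbols are
   their sum type.  [var_inf] is the usual supply of fresh variables. *)
Record signature := Signature {
  srt : finType;
  con : finType;
  dfn : finType;
  var : choiceType;
  arg_sorts : con + dfn -> seq srt;
  res_sort : con + dfn -> srt;
  var_sort : var -> srt;
  var_inf : forall (s : srt) (xs : seq var),
    exists x, var_sort x = s /\ x \notin xs
}.

Definition sym (Sg : signature) : Type := (con Sg + dfn Sg)%type.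

(* Raw terms; respecting the base declarations is the predicate [wf]. *)
Inductive term (Sg : signature) : Type :=
| Var of var Sg
| Fun of sym Sg & seq (term Sg).

Arguments Var {Sg}.
Arguments Fun {Sg}.

Section Rewriting.
Variable Sg : signature.
Notation term := (term Sg).
Notation var := (var Sg).

Definition term_sort (t : term) : srt Sg :=
  match t with Var x => var_sort x | Fun f _ => res_sort f end.

Fixpoint wf (t : term) : bool :=
  match t with
  | Var _ => true
  | Fun f ts => all wf ts && (map term_sort ts == arg_sorts f)
  end.

Fixpoint vars (t : term) : seq var :=
  match t with Var x => [:: x] | Fun _ ts => flatten (map vars ts) end.

Definition ground (t : term) : Prop := vars t = [::].

Fixpoint no_defined (t : term) : bool :=
  match t with
  | Var _ => true
  | Fun (inl _) ts => all no_defined ts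
  | Fun (inr _) _ => false
  end.

Definition value (t : term) : Prop := [/\ wf t, ground t & no_defined t].

Fixpoint tmap (h : var -> term) (t : term) : term :=
  match t with Var x => h x | Fun f ts => Fun f (map (tmap h) ts) end.

Definition rename (h : var -> var) : term -> term := tmap (fun x => Var (h x)).

Definition subst : Type := {fmap var -> term}.

Definition app (sigma : subst) : term -> term :=
  tmap (fun x => odflt (Var x) (sigma.[? x])%fmap).

Definition typed_subst (sigma : subst) : Prop :=
  forall x t, (sigma.[? x])%fmap = Some t -> wf t /\ term_sort t = var_sort x.

Definition normalised (sigma : subst) : Prop :=
  typed_subst sigma /\ forall x t, (sigma.[? x])%fmap = Some t -> value t.

Record rule : Type := Rule {
  rule_sym : dfn Sg;
  rule_args : seq term;
  rule_rhs : term
}.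

Definition rule_lhs (rho : rule) : term :=
  Fun (inr (rule_sym rho)) (rule_args rho).

Definition rule_wf (rho : rule) : Prop :=
  [/\ wf (rule_lhs rho) /\ wf (rule_rhs rho),
      all no_defined (rule_args rho),
      term_sort (rule_lhs rho) = term_sort (rule_rhs rho)
    & {subset vars (rule_rhs rho) <= vars (rule_lhs rho)}].

Definition variant (rho rho' : rule) : Prop :=
  exists h : var -> var,
    [/\ injective h, forall x, var_sort (h x) = var_sort x
      & rho' = Rule (rule_sym rho) (map (rename h) (rule_args rho))
                    (rename h (rule_rhs rho))].

Inductive subterm (u : term) : term -> Prop :=
| subterm_refl : subterm u u
| subterm_arg f ts t : List.In t ts -> subterm u t -> subterm u (Fun f ts).

Definition proper_subterm (u t : term) : Prop :=
  match t with
  | Var _ => False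
  | Fun _ ts => exists2 s, List.In s ts & subterm u s
  end.

Definition is_var (t : term) : bool := if t is Var _ then true else false.

Definition unifiable (s t : term) : Prop :=
  exists2 sigma, typed_subst sigma & app sigma s = app sigma t.

Inductive step (R : set rule) : term -> term -> Prop :=
| step_root rho sigma :
    R rho -> typed_subst sigma ->
    step R (app sigma (rule_lhs rho)) (app sigma (rule_rhs rho))
| step_arg f ss1 s t ss2 :
    step R s t -> step R (Fun f (ss1 ++ s :: ss2)) (Fun f (ss1 ++ t :: ss2)).

Definition left_linear (R : set rule) : Prop :=
  forall rho, R rho -> uniq (vars (rule_lhs rho)).

(* A rule overlapping a variant of itself at the root is not an overlap. *)
Definition non_overlapping (R : set rule) : Prop :=
  forall rho1 rho2 rho1' rho2' : rule,
    R rho1 -> R rho2 -> variant rho1 rho1' -> variant rho2 rho2' ->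
    (forall x, x \in vars (rule_lhs rho1') -> x \notin vars (rule_lhs rho2')) ->
    (forall u, proper_subterm u (rule_lhs rho1') -> ~~ is_var u ->
       ~ unifiable u (rule_lhs rho2')) /\
    (~ variant rho1 rho2 -> ~ unifiable (rule_lhs rho1') (rule_lhs rho2')).

Definition completely_defined (R : set rule) : Prop :=
  forall t, wf t -> ground t -> (forall u, ~ step R t u) -> value t.

Record is_trs (R : set rule) : Prop := IsTrs {
  trs_finite : finite_set R;
  trs_rule_wf : forall rho, R rho -> rule_wf rho;
  trs_left_linear : left_linear R;
  trs_non_overlapping : non_overlapping R;
  trs_completely_defined : completely_defined R
}.

Definition bind (xs : seq var) (ts : seq term) : subst :=
  foldr (fun xt (rho : subst) => rho.[xt.1 <- xt.2]%fmap) [fmap]%fmap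
        (zip xs ts).

(* Rules are used up to renaming: otherwise the disjointness required by the
   union of sigma and tau would forbid any recursive call. *)
Inductive eval (R : set rule) : subst -> term -> nat -> term -> Prop :=
| eval_var sigma x v :
    app sigma (Var x) = v -> value v -> eval R sigma (Var x) 0 v
| eval_con sigma (c : con Sg) xs vs :
    [seq app sigma (Var x) | x <- xs] = vs ->
    (forall v, List.In v vs -> value v) ->
    eval R sigma (Fun (inl c) (map Var xs)) 0 (Fun (inl c) vs)
| eval_rule sigma tau rho rho' xs m v :
    R rho -> variant rho rho' ->
    normalised tau -> [disjoint domf sigma & domf tau]%fset ->
    [seq app sigma (Var x) | x <- xs] = map (app tau) (rule_args rho') ->
    eval R (catf sigma tau) (rule_rhs rho') m v ->
    eval R sigma (Fun (inr (rule_sym rho')) (map Var xs)) m.+1 v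
| eval_app n sigma f (xs : n.-tuple var) (ts vs : n.-tuple term)
    (m0 : nat) (ms : n.-tuple nat) v :
    uniq xs ->
    (forall x, x \in xs -> x \notin domf sigma /\ x \notin vars (Fun f ts)) ->
    normalised (bind xs vs) ->
    (forall i : 'I_n, eval R sigma (tnth ts i) (tnth ms i) (tnth vs i)) ->
    eval R (catf sigma (bind xs vs)) (Fun f (map Var xs)) m0 v ->
    eval R sigma (Fun f ts) (m0 + \sum_(i < n) tnth ms i)%N v.

Definition annot : Type := seq {nonneg rat}.

Definition annot_nth (p : annot) (i : nat) : {nonneg rat} := nth 0%:nng p i.

Definition annot_add (p q : annot) : annot :=
  mkseq (fun i => ((annot_nth p i)%:num + (annot_nth q i)%:num)%:nng)
        (maxn (size p) (size q)).

Definition annot_le (p q : annot) : Prop :=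
  forall i, (annot_nth p i)%:num <= (annot_nth q i)%:num.

Definition annot_scale (a : {nonneg rat}) (p : annot) : annot :=
  [seq (a%:num * b%:num)%:nng | b : {nonneg rat} <- p].

Definition atype : Type := (srt Sg * annot)%type.

Definition atype_add (A B : atype) : atype := (A.1, annot_add A.2 B.2).
Definition atype_scale (a : {nonneg rat}) (A : atype) : atype :=
  (A.1, annot_scale a A.2).

Definition share (A A1 A2 : atype) : Prop :=
  [/\ A.1 = A1.1, A.1 = A2.1 & annot_add A1.2 A2.2 = A.2].

Definition subtype (A B : atype) : Prop := A.1 = B.1 /\ annot_le B.2 A.2.

(* ((As, p), C) is the declaration A_1 x ... x A_n -p-> C. *)
Definition decl : Type := (seq atype * {nonneg rat} * atype)%type.
Definition decl_args (d : decl) : seq atype := d.1.1.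
Definition decl_cost (d : decl) : {nonneg rat} := d.1.2.
Definition decl_res (d : decl) : atype := d.2.

Definition decl_add (d e : decl) : decl :=
  ([seq atype_add AB.1 AB.2 | AB <- zip (decl_args d) (decl_args e)],
   ((decl_cost d)%:num + (decl_cost e)%:num)%:nng,
   atype_add (decl_res d) (decl_res e)).

Definition decl_scale (a : {nonneg rat}) (d : decl) : decl :=
  (map (atype_scale a) (decl_args d), (a%:num * (decl_cost d)%:num)%:nng,
   atype_scale a (decl_res d)).

Record is_annotated_signature (F : sym Sg -> set decl) : Prop :=
  IsAnnotatedSignature {
    asig_nonempty : forall f, exists d, F f d;
    asig_base : forall f d, F f d ->
      [seq A.1 | A <- decl_args d] = arg_sorts f
      /\ (decl_res d).1 = res_sort f;
    asig_unique : forall f (v : annot),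
      exists! d, F f d /\ decl_res d = (res_sort f, v);
    asig_scale : forall (c : con Sg) d (a : {nonneg rat}),
      F (inl c) d -> F (inl c) (decl_scale a d);
    asig_add : forall (c : con Sg) d e,
      F (inl c) d -> F (inl c) e -> F (inl c) (decl_add d e)
  }.

(* The unique declaration of f with result C, chosen classically; the default
   is only returned when there is none. *)
Definition decl_with_res (F : sym Sg -> set decl) (f : sym Sg) (C : atype) :
    decl :=
  xget ([::], 0%:nng, C) (fun d => F f d /\ decl_res d = C).

(* Only meaningful on values, at an annotated type over their sort. *)
Fixpoint potential (F : sym Sg -> set decl) (t : term) (C : atype) : rat :=
  match t with
  | Var _ => 0
  | Fun f ts =>
    let d := decl_with_res F f C in
    (decl_cost d)%:num +
    (fix potentials (ts : seq term) (As : seq atype) : rat :=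
       match ts, As with
       | t :: ts', A :: As' => potential F t A + potentials ts' As'
       | _, _ => 0
       end) ts (decl_args d)
  end.

Definition ctx : Type := {fmap var -> atype}.

Definition ctx_of (xs : seq var) (As : seq atype) : ctx :=
  foldr (fun xA (Gamma : ctx) => Gamma.[xA.1 <- xA.2]%fmap) [fmap]%fmap
        (zip xs As).

Definition well_typed_subst (sigma : subst) (Gamma : ctx) : Prop :=
  forall x : domf Gamma,
    value (app sigma (Var (val x)))
    /\ term_sort (app sigma (Var (val x))) = (Gamma x).1.

Definition ctx_potential (F : sym Sg -> set decl) (sigma : subst)
    (Gamma : ctx) : rat :=
  \sum_(x : domf Gamma) potential F (app sigma (Var (val x))) (Gamma x).

(* The side conditions [var_sort x = A.1] say that contexts respect the sorts
   of variables; every derivable cost is nonnegative. *)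
Inductive typing (F : sym Sg -> set decl) :
    ctx -> rat -> term -> atype -> Prop :=
| ty_decl f (xs : seq var) As (p : {nonneg rat}) C :
    F f (As, p, C) -> uniq xs -> map (@var_sort Sg) xs = [seq A.1 | A <- As] ->
    typing F (ctx_of xs As) p%:num (Fun f (map Var xs)) C
| ty_cost Gamma p p' t C :
    typing F Gamma p t C -> p <= p' -> typing F Gamma p' t C
| ty_comp n f (xs : n.-tuple var) (As : n.-tuple atype) (p0 : rat)
    (Gammas : n.-tuple ctx) (ps : n.-tuple rat) (ts : n.-tuple term) C :
    uniq xs ->
    (forall x, x \in xs -> x \notin vars (Fun f ts) /\
       forall i : 'I_n, x \notin domf (tnth Gammas i)) ->
    typing F (ctx_of xs As) p0 (Fun f (map Var xs)) C ->
    (forall i : 'I_n,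
       typing F (tnth Gammas i) (tnth ps i) (tnth ts i) (tnth As i)) ->
    (forall i j : 'I_n, i != j ->
       [disjoint domf (tnth Gammas i) & domf (tnth Gammas j)]%fset) ->
    typing F (\big[@catf _ _/[fmap]%fmap]_(i < n) tnth Gammas i)
           (p0 + \sum_(i < n) tnth ps i) (Fun f ts) C
| ty_weak Gamma (x : var) A p t C :
    typing F Gamma p t C -> x \notin domf Gamma -> var_sort x = A.1 ->
    typing F Gamma.[x <- A]%fmap p t C
| ty_share Gamma (x y z : var) A A1 A2 p t C :
    typing F Gamma.[x <- A1].[y <- A2]%fmap p t C ->
    share A A1 A2 -> uniq [:: x; y; z] ->
    x \notin domf Gamma -> y \notin domf Gamma -> z \notin domf Gamma ->
    var_sort z = A.1 ->
    typing F Gamma.[z <- A]%fmap p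
           (rename (fun w => if w \in [:: x; y] then z else w) t) C
| ty_sub Gamma (x : var) A B p t C :
    typing F Gamma.[x <- B]%fmap p t C -> x \notin domf Gamma -> subtype A B ->
    typing F Gamma.[x <- A]%fmap p t C
| ty_var (x : var) A :
    var_sort x = A.1 -> typing F [fmap].[x <- A]%fmap 0 (Var x) A
| ty_super Gamma p t C D :
    typing F Gamma p t D -> subtype D C -> typing F Gamma p t C.

Definition well_typed_symbol (F : sym Sg -> set decl) (R : set rule)
    (f : dfn Sg) : Prop :=
  forall n (ls : n.-tuple term) r, R (Rule f ls r) ->
  forall (As : n.-tuple atype) (p : {nonneg rat}) C,
    F (inr f) (tval As, p, C) ->
  forall (Gamma : ctx) (ks : n.-tuple rat),
    domf Gamma =i vars (Fun (inr f) ls) ->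
    (forall i : 'I_n, typing F Gamma (tnth ks i) (tnth ls i) (tnth As i)) ->
    typing F Gamma (p%:num - 1 + \sum_(i < n) tnth ks i) r C.

Definition well_typed_trs (F : sym Sg -> set decl) (R : set rule) : Prop :=
  forall f, well_typed_symbol F R f.

End Rewriting.

(* Main.v *)
Require Import Defs.
From HB Require Import structures.
From mathcomp Require Import all_boot all_order all_algebra.
From mathcomp Require Import finmap interval_inference.
From mathcomp Require Import boolp classical_sets cardinality.
From mathcomp Require Import lra.

Set Implicit Arguments.
Unset Strict Implicit.
Unset Printing Implicit Defensive.

Import Order.TTheory GRing.Theory Num.Theory.
Local Open Scope ring_scope.

(** Potentials are additive along sharing, because the declarations of a
constructor are closed under addition and determined by their result, and hence
monotone along subtyping.  An evaluation of [t] under [sigma] is an evaluation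
of the instance of [t] by [sigma] in an environment-free semantics.  There the
bound is proved by induction on the cost [m], with an inner induction on the
typing derivation.  The only step that consumes a unit of cost applies a rule
[f(l_1, ..., l_n) -> r] with matching substitution [tau]: by left-linearity the
potential of the arguments can be redistributed exactly over a context for the
variables of the [l_i] together with the costs of typing the [l_i], so that
well-typedness types [r] at the remaining cost, and the outer induction
hypothesis applies to [r] under [tau]. *)

(** * Terms, their instances, and values *)

Section TermTheory.
Variable Sg : signature.
Implicit Types (t v : term Sg) (ts vs : seq (term Sg)) (h : var Sg -> term Sg).

(** The generated induction principle gives no hypothesis for terms nested in a [seq]; the inner
    list induction supplies one for each argument. *)
Lemma term_ind_Forall (P : term Sg -> Prop) :
    (forall x, P (Var x)) ->
    (forall f ts, List.Forall P ts -> P (Fun f ts)) ->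
  forall t, P t.
Proof.
move=> PV PF; fix IH 1; case=> [x|f ts]; first exact: PV.
apply: PF; elim: ts => [|t ts IHts]; first exact: List.Forall_nil.
by apply: List.Forall_cons.
Qed.

Lemma tmap_comp h h' t : tmap h (tmap h' t) = tmap (fun x => tmap h (h' x)) t.
Proof.
elim/term_ind_Forall: t => [//|f ts IH] /=; congr Fun.
by elim: IH => //= t ts' -> _ ->.
Qed.

Lemma eq_tmap h h' t :
  (forall x, x \in vars t -> h x = h' x) -> tmap h t = tmap h' t.
Proof.
elim/term_ind_Forall: t => [x|f ts IH] /= E; first by rewrite E ?mem_head.
congr Fun; elim: IH E => //= t ts' IHt _ IHts E.
rewrite IHt ?IHts // => x xt; apply: E; rewrite mem_cat xt ?orbT //.
Qed.

Lemma vars_rename (g : var Sg -> var Sg) t :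
  vars (rename g t) = map g (vars t).
Proof.
elim/term_ind_Forall: t => [//|f ts IH] /=.
by elim: IH => //= t ts' -> _ ->; rewrite map_cat.
Qed.

Lemma tmap_sort h t :
    (forall x, x \in vars t -> wf (h x) /\ term_sort (h x) = var_sort x) ->
  wf (tmap h t) = wf t /\ term_sort (tmap h t) = term_sort t.
Proof.
elim/term_ind_Forall: t => [x|f ts IH] /= E.
  by have [] := E x (mem_head _ _).
split=> //.
suff [-> ->] : all (@wf Sg) (map (tmap h) ts) = all (@wf Sg) ts /\
  map (@term_sort Sg) (map (tmap h) ts) = map (@term_sort Sg) ts by [].
elim: IH E => //= t ts' IHt _ IHts E.
have [|-> ->] := IHt; first by move=> x xt; apply: E; rewrite mem_cat xt.
by have [|-> ->] := IHts; first by move=> x xt; apply: E; rewrite mem_cat xt orbT.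
Qed.

Lemma value_Fun f ts : value (Fun f ts) <->
  [/\ List.Forall (@value Sg) ts, map (@term_sort Sg) ts = arg_sorts f &
      exists c, f = inl c].
Proof.
split.
  case=> /= /andP[wts /eqP srts] gts; case: f srts gts => // c srts gts nts.
  split=> //; last by exists c.
  rewrite /ground /= in gts; elim: ts wts gts nts {srts} => [|t ts IH] /=; first by constructor.
  case/andP=> wt wts E /andP[nt nts].
  have gt : vars t = [::] by case: (vars t) E.
  move: E; rewrite gt /= => E.
  by constructor; [split | apply: IH].
case=> vts /eqP srts [c ?]; subst f; rewrite /value /ground /= srts andbT.
elim: vts {srts} => //= t ts' [-> -> ->] _ [-> -> ->]; by split.
Qed.

(** For matching: when the instances of the patterns of a rule are values, so is the image of every
    pattern variable. *)
Lemma value_tmap_var h t x : value (tmap h t) -> x \in vars t -> value (h x).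
Proof.
elim/term_ind_Forall: t => [y|f ts IH] /=; first by rewrite inE => vh /eqP->.
case/value_Fun=> vts _ _; elim: IH vts => //= t ts' IHt _ IHts.
move/List.Forall_cons_iff=> [vt vts]; rewrite mem_cat => /orP[/IHt|/IHts]; exact.
Qed.

End TermTheory.

(** * Finite maps: iterated updates, disjoint unions, and sums over entries *)

Local Notation fmap_of xs ys :=
  (foldr (fun xy (f : {fmap _ -> _}) => f.[xy.1 <- xy.2]%fmap) [fmap]%fmap
     (zip xs ys)).

Section FmapTheory.
Variables (K : choiceType) (V : Type).
Implicit Types (f g : {fmap K -> V}).

(** Both [bind] and [ctx_of] have this form. In the iterated update the first occurrence of a key
    shadows later ones, hence [uniq]. *)
Lemma fnd_foldr_set (xs : seq K) (ys : seq V) :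
    uniq xs -> size xs = size ys ->
  let f := fmap_of xs ys in
  map (fun x => f.[? x]%fmap) xs = map Some ys.
Proof.
elim: xs ys => [|x xs IH] [|y ys] //= /andP[xxs uxs] [szE].
rewrite fnd_set eqxx -(IH ys uxs szE); congr cons.
apply/eq_in_map => z zxs; rewrite fnd_set; case: eqP => // zx.
by rewrite -zx zxs in xxs.
Qed.

Lemma mem_foldr_set (xs : seq K) (ys : seq V) :
    size xs = size ys ->
  domf (fmap_of xs ys) =i xs.
Proof.
elim: xs ys => [|x xs IH] [|y ys] //= [szE] z.
by rewrite !inE IH.
Qed.

Lemma mem_big_catf n (G : 'I_n -> {fmap K -> V}) x :
  (x \in domf (\big[@catf _ _/[fmap]%fmap]_(j < n) G j)) =
  [exists i, x \in domf (G i)].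
Proof.
elim: n G => [|n IH] G.
  by rewrite big_ord0 inE; apply/esym/negbTE/existsP => -[[]].
rewrite big_ord_recl mem_catf IH; apply/orP/existsP => [[x0|]|[i]].
- by exists ord0.
- by case/existsP=> j; exists (lift ord0 j).
- case: (unliftP ord0 i) => [j ->|->] xi; last by left.
  by right; apply/existsP; exists j.
Qed.

Definition pairwise_disjoint n (G : 'I_n -> {fmap K -> V}) :=
  forall i j, i != j -> [disjoint domf (G i) & domf (G j)]%fset.

Lemma pairwise_disjoint_lift n (G : 'I_n.+1 -> {fmap K -> V}) :
  pairwise_disjoint G -> pairwise_disjoint (fun j => G (lift ord0 j)).
Proof. by move=> dG i j ij; apply: dG; rewrite (inj_eq (@lift_inj _ _)). Qed.

Lemma pairwise_disjoint_recl n (G : 'I_n.+1 -> {fmap K -> V}) :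
    pairwise_disjoint G ->
  [disjoint domf (G ord0) &
    domf (\big[@catf _ _/[fmap]%fmap]_(j < n) G (lift ord0 j))]%fset.
Proof.
move=> dG; apply/fdisjointP => x x0; rewrite mem_big_catf.
apply/negP => /existsP[j xj].
by have /fdisjointP/(_ x x0) := dG ord0 (lift ord0 j) isT; rewrite xj.
Qed.

(** [catf] prefers its right operand; disjointness makes this bias invisible. *)
Lemma fnd_big_catf n (G : 'I_n -> {fmap K -> V}) i x :
    pairwise_disjoint G -> x \in domf (G i) ->
  ((\big[@catf _ _/[fmap]%fmap]_(j < n) G j).[? x] = (G i).[? x])%fmap.
Proof.
elim: n G i => [|n IH] G i dG xi; first by case: i xi.
rewrite big_ord_recl fnd_cat.
case: (unliftP ord0 i) xi => [j ->|->] xi.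
  rewrite mem_big_catf; case: existsP => [_|[]]; last by exists j.
  by rewrite (IH (fun j => G (lift ord0 j)) j) //; apply: pairwise_disjoint_lift.
by rewrite ifN //; move/fdisjointP: (pairwise_disjoint_recl dG); apply.
Qed.

(** Summing over the list of keys with a partial lookup, instead of over the finite type [domf f],
    avoids transporting indices when the domain changes. *)
Definition fmap_sum (w : K -> V -> rat) f : rat :=
  \sum_(x <- domf f) oapp (w x) 0 f.[? x]%fmap.

Lemma fmap_sumE w f : fmap_sum w f = \sum_(x : domf f) w (val x) (f x).
Proof.
rewrite /fmap_sum big_seq_fsetE; apply: eq_bigr => x _.
by rewrite -Some_fnd.
Qed.

Lemma fmap_sum0 w : fmap_sum w [fmap]%fmap = 0.
Proof. by rewrite /fmap_sum big_seq big_pred0. Qed.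

Lemma fmap_sum_cat w f g :
    [disjoint domf f & domf g]%fset ->
  fmap_sum w (catf f g) = fmap_sum w f + fmap_sum w g.
Proof.
move=> dfg; rewrite /fmap_sum.
rewrite (perm_big (domf f ++ domf g)) /=; last first.
  apply: uniq_perm; rewrite ?fset_uniq //.
    rewrite cat_uniq !fset_uniq andbT /=; apply/hasPn => x xg; apply/negP => xf.
    by move/fdisjointP: dfg => /(_ x xf); rewrite xg.
  by move=> x; rewrite mem_cat mem_catf.
rewrite big_cat /= big_seq [in RHS]big_seq; congr (_ + _).
  apply: eq_bigr => x xf; rewrite fnd_cat ifN //.
  by move/fdisjointP: dfg; apply.
rewrite big_seq [in RHS]big_seq.
by apply: eq_bigr => x xg; rewrite fnd_cat xg.
Qed.

Lemma fmap_sum_set w f x y :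
  x \notin domf f -> fmap_sum w f.[x <- y]%fmap = w x y + fmap_sum w f.
Proof.
move=> xf; pose g z := oapp (w z) 0 (f.[x <- y].[? z])%fmap.
rewrite -[LHS]/(\sum_(z <- domf f.[x <- y]%fmap) g z) dom_setf big_fsetU1 //=.
rewrite {1}/g fnd_set eqxx /=.
congr (_ + _); rewrite /fmap_sum big_seq [in RHS]big_seq; apply: eq_bigr => z zf.
by rewrite /g fnd_set; case: eqP => // zx; rewrite -zx zf in xf.
Qed.

Lemma fmap_sum_big_catf w n (G : 'I_n -> {fmap K -> V}) :
    pairwise_disjoint G ->
  fmap_sum w (\big[@catf _ _/[fmap]%fmap]_(j < n) G j) =
  \sum_(j < n) fmap_sum w (G j).
Proof.
elim: n G => [|n IH] G dG; first by rewrite !big_ord0 fmap_sum0.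
rewrite !big_ord_recl fmap_sum_cat; last exact: pairwise_disjoint_recl.
by rewrite IH //; apply: pairwise_disjoint_lift.
Qed.

Lemma eq_fmap_sum w w' f :
  (forall x y, f.[? x]%fmap = Some y -> w x y = w' x y) ->
  fmap_sum w f = fmap_sum w' f.
Proof.
move=> E; apply: eq_bigr => x _.
by case fx: (f.[? x])%fmap => [y|] //=; apply: E.
Qed.

Lemma fmap_sum_foldr w (xs : seq K) (ys : seq V) :
    uniq xs -> size xs = size ys ->
  fmap_sum w (fmap_of xs ys) = \sum_(xy <- zip xs ys) w xy.1 xy.2.
Proof.
elim: xs ys => [|x xs IH] [|y ys] //= => [_ _|/andP[xxs uxs] [szE]].
  by rewrite fmap_sum0 big_nil.
rewrite fmap_sum_set; last by rewrite mem_foldr_set.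
by rewrite big_cons IH.
Qed.

End FmapTheory.

(** * Potentials of values: additivity and monotonicity in the annotation *)

Section Potential.
Variables (Sg : signature) (F : sym Sg -> set (decl Sg)).
Hypothesis asigF : is_annotated_signature F.
Implicit Types (v : term Sg) (A B C : atype Sg) (As Bs : seq (atype Sg)).

(** A named copy of the anonymous inner fixpoint of [potential], to which it is convertible. *)
Fixpoint potentials (ts : seq (term Sg)) As : rat :=
  match ts, As with
  | t :: ts', A :: As' => potential F t A + potentials ts' As'
  | _, _ => 0
  end.

Lemma potential_Fun f ts C :
  potential F (Fun f ts) C =
  (decl_cost (decl_with_res F f C))%:num +
  potentials ts (decl_args (decl_with_res F f C)).
Proof. by []. Qed.

Lemma potentialsE n (ts : n.-tuple (term Sg)) (As : n.-tuple (atype Sg)) :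
  potentials ts As = \sum_(i < n) potential F (tnth ts i) (tnth As i).
Proof.
elim: n ts As => [|n IH] ts As.
  by rewrite (tuple0 ts) (tuple0 As) big_ord0.
case/tupleP: ts => t ts; case/tupleP: As => A As.
rewrite big_ord_recl !tnth0 /= IH; congr (_ + _).
by apply: eq_bigr => i _; rewrite !tnthS.
Qed.

Lemma potential_ge0 v A : 0 <= potential F v A.
Proof.
elim/term_ind_Forall: v A => [//|f ts IH] A; rewrite potential_Fun addr_ge0 //.
move: (decl_args _); elim: IH => [|t ts' IHt _ IHts] [|B Bs] //=.
by rewrite addr_ge0.
Qed.

Lemma decl_with_resP f C : C.1 = res_sort f ->
  F f (decl_with_res F f C) /\ decl_res (decl_with_res F f C) = C.
Proof.
case: C => s a /= ->; have [d [Hd _]] := asig_unique asigF f a.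
by rewrite /decl_with_res; case: xgetP => [e -> //|/(_ d)].
Qed.

(** By uniqueness of the declaration with a given result, the classical choice recovers [d]. *)
Lemma decl_with_res_eq f d : F f d -> decl_with_res F f (decl_res d) = d.
Proof.
move=> Fd; have [_ rd] := asig_base asigF Fd.
have [Fe re] := decl_with_resP rd.
have [d' [_ U]] := asig_unique asigF f (decl_res d).2.
have rE : decl_res d = (res_sort f, (decl_res d).2) by rewrite -rd; case: decl_res.
by rewrite -[RHS](U d) // -[LHS](U) // re.
Qed.

Lemma decl_with_res_sorts f C : C.1 = res_sort f ->
  [seq A.1 | A <- decl_args (decl_with_res F f C)] = arg_sorts f.
Proof. by case/decl_with_resP => /(asig_base asigF)[]. Qed.

(** Closure under addition makes the sum a declaration of [c], its result is [atype_add C D], and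
    uniqueness identifies it with the chosen one. *)
Lemma decl_with_res_add c C D :
    C.1 = res_sort (inl c) -> D.1 = res_sort (inl c) ->
  decl_with_res F (inl c) (atype_add C D) =
  decl_add (decl_with_res F (inl c) C) (decl_with_res F (inl c) D).
Proof.
move=> /decl_with_resP[FC rC] /decl_with_resP[FD rD].
have := decl_with_res_eq (asig_add asigF FC FD).
by rewrite /decl_add /decl_res /= -!/(decl_res _) rC rD.
Qed.

Lemma potential_add v A B :
    value v -> A.1 = term_sort v -> B.1 = term_sort v ->
  potential F v (atype_add A B) = potential F v A + potential F v B.
Proof.
elim/term_ind_Forall: v A B => [x|f ts IH] A B; first by case.
case/value_Fun=> vts srts [c ?]; subst f => sA sB.
rewrite !potential_Fun decl_with_res_add //= addrACA; congr (_ + _).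
move: (decl_with_res_sorts sA) (decl_with_res_sorts sB); rewrite -srts.
rewrite /decl_add /decl_args /= -!/(decl_args _).
move: (decl_args _) (decl_args _) => As Bs {srts sA sB}.
elim: IH vts As Bs => [|t ts' IHt _ IHts] vts [|A' As] [|B' Bs] //=.
case=> sA sAs [sB sBs]; move/List.Forall_cons_iff: vts => [vt vts].
by rewrite IHt // IHts // addrACA.
Qed.

Definition nonneg0 : {nonneg rat} := 0%:nng.

(** Scaling by zero maps the declaration with a zero result to one with the same result, so by
    uniqueness the declaration equals its own zero multiple. Its cost and all its argument
    annotations therefore vanish, and induction applies to the arguments. *)
Lemma potential_zero v s n :
    value v -> s = term_sort v ->
  potential F v (s, nseq n nonneg0) = 0.
Proof.
elim/term_ind_Forall: v s n => [x|f ts IH] s n; first by case.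
case/value_Fun=> vts srts [c ?] E; subst f s => /=.
set C := (_, _); pose d := decl_with_res F (inl c) C.
have [Fd rd] := @decl_with_resP (inl c) C erefl.
rewrite -/d in Fd rd.
have := decl_with_res_eq (asig_scale asigF nonneg0 Fd).
have -> : decl_res (decl_scale nonneg0 d) = C.
  rewrite /decl_scale /decl_res /= -!/(decl_res _) rd /C /atype_scale /=.
  congr pair; rewrite /annot_scale map_nseq; congr nseq.
  by apply/val_inj; rewrite /= mul0r.
rewrite -/d => dE.
have cd : (decl_cost d)%:num = 0 by rewrite dE /decl_cost /= mul0r.
have dargs : decl_args d = map (atype_scale nonneg0) (decl_args d).
  by rewrite {1}dE.
have := @decl_with_res_sorts (inl c) C erefl; rewrite -srts -/d.
rewrite -/(potentials ts (decl_args d)) cd add0r dargs.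
move: (decl_args _) => As {Fd rd dE cd dargs d srts C}.
elim: IH vts As => [|t ts' IHt _ IHts] vts [|A' As] //= [sA sAs].
move/List.Forall_cons_iff: vts => [vt vts].
rewrite IHts // addr0 /atype_scale.
have -> : annot_scale nonneg0 A'.2 = nseq (size A'.2) nonneg0.
  by rewrite /annot_scale; elim: (A'.2) => //= b a ->; congr cons;
    apply/val_inj; rewrite /= mul0r.
exact: IHt.
Qed.

Lemma annot_nth_add p q i :
  (annot_nth (annot_add p q) i)%:num = (annot_nth p i)%:num + (annot_nth q i)%:num.
Proof.
rewrite {1}/annot_nth /annot_add; case: (ltnP i (maxn (size p) (size q))) => lt.
  by rewrite nth_mkseq.
rewrite nth_default ?size_mkseq //= /annot_nth.
by move: lt; rewrite geq_max => /andP[lp lq]; rewrite !nth_default //= addr0.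
Qed.

(* The smaller annotation may be the longer list, so the larger one is first
   padded with zeros, which does not change the potential. *)
Lemma potential_le v A B :
    value v -> A.1 = term_sort v -> subtype A B ->
  potential F v B <= potential F v A.
Proof.
case: A B => s a [s' b] vv /= sv [/= ss' le]; subst s'.
pose n := size b; pose N := maxn (size a) n.
have sub_ge0 i : 0 <= (annot_nth a i)%:num - (annot_nth b i)%:num.
  by rewrite subr_ge0.
(* The difference of [a] and [b]. The two sums in [E] must be equal as lists, so [e] gets the length
   [N] of the padded [a]. *)
pose e : annot := mkseq (fun i => NngNum (sub_ge0 i)) N.
have E : atype_add (s, a) (s, nseq n nonneg0) = atype_add (s, b) (s, e).
  rewrite /atype_add /=; congr pair.
  have szE : size (annot_add b e) = size (annot_add a (nseq n nonneg0)).
    by rewrite !size_mkseq size_nseq -/n -/N maxnC; apply/maxn_idPl/leq_maxr.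
  apply: (@eq_from_nth _ nonneg0) => // i.
  move=> lti; apply/val_inj.
  have iN : (i < N)%N by move: lti; rewrite size_mkseq size_nseq.
  change ((annot_nth (annot_add a (nseq n nonneg0)) i)%:num =
          (annot_nth (annot_add b e) i)%:num).
  rewrite !annot_nth_add.
  rewrite {2}/annot_nth nth_nseq if_same /= addr0 {3}/annot_nth nth_mkseq //=.
  by rewrite addrC subrK.
rewrite -[leRHS]addr0 -(@potential_zero v s n) // -potential_add // E.
by rewrite potential_add // lerDl potential_ge0.
Qed.

Lemma potential_share v A A1 A2 :
    value v -> A.1 = term_sort v -> share A A1 A2 ->
  potential F v A = potential F v A1 + potential F v A2.
Proof.
move=> vv sA [s1 s2 E]; rewrite -potential_add // -?s1 -?s2 //.
by rewrite /atype_add E -s1; case: (A).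
Qed.

End Potential.

Lemma Forall_map_in (T : eqType) (U : Type) (P : U -> Prop) (h : T -> U)
    (xs : seq T) :
  (forall x, x \in xs -> P (h x)) -> List.Forall P (map h xs).
Proof.
elim: xs => [|x xs IH] Ph /=; constructor; first by apply: Ph; rewrite mem_head.
by apply: IH => y yxs; apply: Ph; rewrite inE yxs orbT.
Qed.

Lemma mem_vars_tnth (Sg : signature) n (ts : n.-tuple (term Sg)) f i x :
  x \in vars (tnth ts i) -> x \in vars (Fun f ts).
Proof.
move=> xi /=; apply/flattenP; exists (vars (tnth ts i)) => //.
by rewrite -tnth_map; apply: (mem_tnth i (map_tuple _ ts)).
Qed.

(** * Environment-free evaluation of instantiated terms *)

Section GroundEvaluation.
Variables (Sg : signature) (R : set (rule Sg)).
Hypothesis trsR : is_trs R.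
Implicit Types (t v : term Sg) (ts vs : seq (term Sg)).

Definition value_of_sort v (s : srt Sg) := value v /\ term_sort v = s.

(* Big-step evaluation of instantiated terms: without an environment there are
   no freshness conditions, so the sharing rule does not require renaming
   evaluation derivations. *)
Inductive geval : term Sg -> nat -> term Sg -> Prop :=
| geval_Fun f ts vs m0 m v :
    gevals ts m vs -> gapply f vs m0 v -> geval (Fun f ts) (m0 + m) v
with gevals : seq (term Sg) -> nat -> seq (term Sg) -> Prop :=
| gevals_nil : gevals [::] 0 [::]
| gevals_cons t ts m ms v vs :
    geval t m v -> gevals ts ms vs -> gevals (t :: ts) (m + ms) (v :: vs)
with gapply : sym Sg -> seq (term Sg) -> nat -> term Sg -> Prop :=
| gapply_con c vs : gapply (inl c) vs 0 (Fun (inl c) vs)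
| gapply_rule rho tau m v :
    R rho ->
    (forall y, y \in vars (rule_lhs rho) -> value_of_sort (tau y) (var_sort y)) ->
    geval (tmap tau (rule_rhs rho)) m v ->
    gapply (inr (rule_sym rho)) (map (tmap tau) (rule_args rho)) m.+1 v.

Scheme geval_mind := Induction for geval Sort Prop
with gevals_mind := Induction for gevals Sort Prop
with gapply_mind := Induction for gapply Sort Prop.
Combined Scheme geval_mutind from geval_mind, gevals_mind, gapply_mind.

Lemma geval_FunP f ts m v :
    geval (Fun f ts) m v ->
  exists vs m0 m1, [/\ m = (m0 + m1)%N, gevals ts m1 vs & gapply f vs m0 v].
Proof.
move tE: (Fun f ts) => t ev; case: ev tE => f' ts' vs m0 m1 w Es Ef [-> ->].
by exists vs, m0, m1.
Qed.

Lemma gevals_nilP m vs : gevals [::] m vs -> m = 0%N /\ vs = [::].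
Proof. by move tsE: [::] => ts ev; case: ev tsE. Qed.

Lemma gevals_consP t ts m vs :
    gevals (t :: ts) m vs ->
  exists v m0 vs' m1, [/\ vs = v :: vs', m = (m0 + m1)%N, geval t m0 v
                        & gevals ts m1 vs'].
Proof.
move tsE: (t :: ts) => us ev; case: ev tsE => // t' ts' m0 m1 v vs' Et Ets [-> ->].
by exists v, m0, vs', m1.
Qed.

Lemma gapply_conP c vs m v :
  gapply (inl c) vs m v -> m = 0%N /\ v = Fun (inl c) vs.
Proof. by move fE: (inl c) => f ev; case: ev fE => // c' vs' ->. Qed.

Lemma gapply_dfnP f vs m v :
    gapply (inr f) vs m v ->
  exists rho tau m',
    [/\ R rho, rule_sym rho = f, m = m'.+1, vs = map (tmap tau) (rule_args rho) &
    (forall y, y \in vars (rule_lhs rho) -> value_of_sort (tau y) (var_sort y))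
    /\ geval (tmap tau (rule_rhs rho)) m' v].
Proof.
move fE: (inr f) => f' ev; case: ev fE => // rho tau m' w Rrho wt Er [->].
by exists rho, tau, m'.
Qed.

Lemma geval_value_refl v : value v -> geval v 0 v.
Proof.
elim/term_ind_Forall: v => [x|f ts IH]; first by case.
case/value_Fun=> vts _ [c ->]; apply: (@geval_Fun _ _ ts 0 0); last by constructor.
elim: IH vts => [_|t ts' IHt _ IHts /List.Forall_cons_iff[vt vts]].
  exact: gevals_nil.
by apply: (@gevals_cons _ _ 0 0); [apply: IHt | apply: IHts].
Qed.

Lemma gevals_value_refl vs : List.Forall (@value Sg) vs -> gevals vs 0 vs.
Proof.
elim=> [|v vs' vv _ IH]; first exact: gevals_nil.
by apply: (@gevals_cons _ _ 0 0) => //; apply: geval_value_refl.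
Qed.

Lemma gevals_value_of ts m vs :
    List.Forall (fun t => forall m v, geval t m v -> m = 0%N /\ v = t) ts ->
  gevals ts m vs -> m = 0%N /\ vs = ts.
Proof.
move=> H; elim: H m vs => [|t ts' Ht _ IH] m vs.
  exact: gevals_nilP.
by case/gevals_consP=> v [m0 [vs' [m1 [-> -> /Ht[-> ->] /IH[-> ->]]]]].
Qed.

Lemma geval_value v m w : value v -> geval v m w -> m = 0%N /\ w = v.
Proof.
elim/term_ind_Forall: v m w => [x|f ts IH] m w; first by case.
case/value_Fun=> vts _ [c ?]; subst f.
case/geval_FunP=> vs [m0 [m1 [-> Es Ef]]].
have [|-> ?] := gevals_value_of _ Es.
  apply/List.Forall_forall => t tin; move/List.Forall_forall: IH => IH.
  by move/List.Forall_forall: vts => vts k w1; apply: IH => //; apply: vts.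
by subst vs; have [-> ->] := gapply_conP Ef.
Qed.

(** Values evaluate only to themselves, at cost 0. Hence an instance of [f(x_1, ..., x_n)] by values
    amounts to a bare application step. *)
Lemma geval_Fun_values f vs m v :
  List.Forall (@value Sg) vs -> geval (Fun f vs) m v <-> gapply f vs m v.
Proof.
move=> vvs; split=> [|E]; last first.
  by rewrite -[m]addn0; apply: geval_Fun E; apply: gevals_value_refl.
case/geval_FunP=> us [m0 [m1 [-> Es Ef]]].
have [|-> ?] := gevals_value_of _ Es; last by subst us; rewrite addn0.
by apply: List.Forall_impl vvs => t vt k w1; apply: geval_value.
Qed.

Lemma gevals_tuple n (ts vs : n.-tuple (term Sg)) (ms : n.-tuple nat) :
    (forall i : 'I_n, geval (tnth ts i) (tnth ms i) (tnth vs i)) ->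
  gevals ts (\sum_(i < n) tnth ms i) vs.
Proof.
elim: n ts vs ms => [|n IH] ts vs ms E.
  by rewrite big_ord0 (tuple0 ts) (tuple0 vs); constructor.
case/tupleP: ts E => t ts; case/tupleP: vs => v vs; case/tupleP: ms => m ms E.
rewrite big_ord_recl tnth0 /=; constructor; first by have := E ord0; rewrite !tnth0.
rewrite (eq_bigr (tnth ms)); last by move=> i _; rewrite tnthS.
by apply: IH => i; have := E (lift ord0 i); rewrite !tnthS.
Qed.

Lemma gevals_tupleP n (ts : n.-tuple (term Sg)) m vs :
    gevals ts m vs ->
  exists (us : n.-tuple (term Sg)) (ms : n.-tuple nat),
    [/\ tval us = vs, m = \sum_(i < n) tnth ms i
      & forall i : 'I_n, geval (tnth ts i) (tnth ms i) (tnth us i)].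
Proof.
elim: n ts m vs => [|n IH] ts m vs.
  rewrite (tuple0 ts) => /gevals_nilP[-> ->].
  by exists [tuple], [tuple]; rewrite big_ord0; split=> // -[].
case/tupleP: ts => t ts /gevals_consP[v [m0 [vs' [m1 [-> -> Et]]]]].
case/IH=> us [ms [<- -> Ei]].
exists [tuple of v :: us], [tuple of m0 :: ms]; split=> //.
  by rewrite big_ord_recl tnth0; congr addn; apply: eq_bigr => i _; rewrite tnthS.
by move=> i; case: (unliftP ord0 i) => [j ->|->]; rewrite ?tnth0 ?tnthS.
Qed.

(** Preservation of sorts. In the rule case the variables of the right-hand side occur on the left,
    where [tau] respects sorts, and both sides of the rule have the same sort. *)
Lemma geval_sound :
  (forall t m v, geval t m v -> wf t -> value_of_sort v (term_sort t)) /\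
  (forall ts m vs, gevals ts m vs -> all (@wf Sg) ts ->
     List.Forall (@value Sg) vs /\
     map (@term_sort Sg) vs = map (@term_sort Sg) ts) /\
  (forall f vs m v, gapply f vs m v -> List.Forall (@value Sg) vs ->
     map (@term_sort Sg) vs = arg_sorts f -> value_of_sort v (res_sort f)).
Proof.
apply: (geval_mutind
  (P := fun t m v _ => wf t -> value_of_sort v (term_sort t))
  (P0 := fun ts m vs _ => all (@wf Sg) ts ->
     List.Forall (@value Sg) vs /\
     map (@term_sort Sg) vs = map (@term_sort Sg) ts)
  (P1 := fun f vs m v _ => List.Forall (@value Sg) vs ->
     map (@term_sort Sg) vs = arg_sorts f -> value_of_sort v (res_sort f))).
- move=> f ts vs m0 m v _ IHs _ IHf /= /andP[/IHs[vvs srtE] /eqP srts].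
  by apply: IHf => //; rewrite srtE.
- by [].
- move=> t ts m ms v vs _ IHt _ IHts /= /andP[/IHt[vv sv] /IHts[vvs svs]].
  by split; [constructor | rewrite sv svs].
- by move=> c vs vvs srts; split=> //; apply/value_Fun; split=> //; exists c.
- move=> rho tau m v Rrho wtau _ IH _ _.
  have [[_ wr] _ sE sub] := trs_rule_wf trsR Rrho.
  have [|wE srtE] := @tmap_sort _ tau (rule_rhs rho).
    by move=> y /sub /wtau[[]].
  by rewrite wE srtE -sE in IH; apply: IH.
Qed.

(** [app] leaves an unbound variable in place, and a variable is not a value; so [x] must be
    bound. *)
Lemma fnd_ground_value (tau : subst Sg) x :
  value (app tau (Var x)) -> exists2 u, (tau.[? x])%fmap = Some u & app tau (Var x) = u.
Proof.
rewrite /app /=; case: (tau.[? x])%fmap => [u|] /=; first by exists u.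
by case.
Qed.

Lemma bind_app (sigma : subst Sg) (xs : seq (var Sg)) vs :
    uniq xs -> size xs = size vs -> 
  [seq app (catf sigma (bind xs vs)) (Var x) | x <- xs] = vs.
Proof.
move=> uxs szE; apply: (inj_map (@Some_inj _)).
rewrite -map_comp -[RHS](fnd_foldr_set uxs szE) -/(bind xs vs).
apply/eq_in_map => x xxs /=; rewrite /app /= fnd_cat mem_foldr_set // xxs.
have : x \in domf (bind xs vs) by rewrite mem_foldr_set.
by rewrite -fndSome; case: (_.[? _])%fmap.
Qed.

(** Induction on the evaluation. The hypothesis on the variables of [t] survives each change of
    environment: a right-hand side only uses variables bound by the match, and the fresh variables
    of a composition are bound to values. *)
Lemma eval_geval (sigma : subst Sg) t m v :
    eval R sigma t m v ->
    (forall x, x \in vars t -> value (app sigma (Var x))) ->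
  geval (app sigma t) m v.
Proof.
elim=> {sigma t m v}.
- by move=> sigma x v <- vv _; apply: geval_value_refl.
- move=> sigma c xs vs <- vvs _; rewrite /app /= -map_comp -/(app sigma).
  apply: (@geval_Fun _ _ _ 0 0); last by constructor.
  by apply: gevals_value_refl; apply/List.Forall_forall => u /vvs.
- move=> sigma tau rho _ xs m v Rrho [g [_ gs ->]] /= [ttau vtau] dst xsE _ IH vx.
  have {}vx : List.Forall (@value Sg) [seq app sigma (Var x) | x <- xs].
    apply: Forall_map_in => x xxs; apply: vx; rewrite -map_comp.
    by apply/flattenP; exists [:: x]; [apply/mapP; exists x | apply: mem_head].
  rewrite /app /= -map_comp -/(app sigma).
  apply/geval_Fun_values => //.
  (* The renaming [g] of the variant is absorbed into the matching substitution, so that [rho]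
     itself is applied. *)
  pose tau' y := app tau (Var (g y)).
  have argsE : [seq app sigma (Var x) | x <- xs] = map (tmap tau') (rule_args rho).
    rewrite xsE -map_comp; apply: eq_map => l /=.
    by rewrite /app /rename tmap_comp.
  have vtau' y : y \in vars (rule_lhs rho) -> value (tau' y).
    rewrite argsE in vx => /= /flattenP[s]; elim: (rule_args rho) vx => //= l ls IHl.
    case/List.Forall_cons_iff=> vl vls; rewrite inE => /orP[/eqP-> yl|].
      exact: value_tmap_var vl yl.
    exact: IHl.
  have [_ _ _ sub] := trs_rule_wf trsR Rrho.
  (* Every variable of the right-hand side occurs on the left, hence is bound by [tau] after
     renaming, and [catf] gives priority to [tau]. *)
  have catE y : y \in vars (rule_rhs rho) ->
      app (catf sigma tau) (Var (g y)) = tau' y.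
    move=> /sub /vtau' vy; have [u tu _] := fnd_ground_value vy.
    by rewrite /tau' /app /= fnd_cat -fndSome tu.
  rewrite -[[seq _ | _ <- xs]]/([seq app sigma (Var x) | x <- xs]) argsE.
  apply: gapply_rule => //.
    move=> y yl; split; first exact: vtau'.
    have [u tu uE] := fnd_ground_value (vtau' y yl).
    by have [_ su] := ttau _ _ tu; rewrite /tau' uE su gs.
  have <- : app (catf sigma tau) (rename g (rule_rhs rho)) =
            tmap tau' (rule_rhs rho).
    by rewrite -(eq_tmap catE) /app /rename tmap_comp.
  apply: IH => x; rewrite vars_rename => /mapP[y yr ->].
  by rewrite catE //; apply/vtau'/sub.
- move=> n sigma f xs ts vs m0 ms v uxs fr [_ nb] _ IHt _ IHf vx.
  have szE : size xs = size vs by rewrite !size_tuple.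
  have xsE := bind_app sigma uxs szE.
  have vxs x : x \in xs -> value (app (catf sigma (bind xs vs)) (Var x)).
    move=> xxs; have : x \in domf (bind xs vs) by rewrite mem_foldr_set.
    move=> xb; rewrite /app /= fnd_cat xb; move: xb; rewrite -fndSome.
    by case E: (_.[? _])%fmap => [u|] //= _; apply: nb E.
  have vvs : List.Forall (@value Sg) vs.
    by rewrite -xsE; apply: Forall_map_in.
  have Ef : gapply f vs m0 v.
    apply/geval_Fun_values => //.
    have <- : app (catf sigma (bind xs vs)) (Fun f (map Var xs)) = Fun f vs.
      by rewrite -[in RHS]xsE /app /= -map_comp.
    apply: IHf => x; rewrite /= -map_comp /= => /flattenP[s /mapP[y yxs ->]].
    by rewrite inE => /eqP->; apply: vxs.
  have Et : gevals [tuple of map (app sigma) ts] (\sum_(i < n) tnth ms i) vs.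
    apply: gevals_tuple => i; rewrite tnth_map; apply: IHt => x xi; apply: vx => /=.
    exact: mem_vars_tnth xi.
  exact: geval_Fun Et Ef.
Qed.

End GroundEvaluation.

(** * Auxiliary facts on tuples, and the supply of fresh variables *)

Lemma fnd_foldr_tnth (K : choiceType) (V : Type) n (xs : n.-tuple K)
    (ys : n.-tuple V) i :
    uniq xs ->
  ((fmap_of xs ys).[? tnth xs i])%fmap = Some (tnth ys i).
Proof.
move=> uxs; have szE : size xs = size ys by rewrite !size_tuple.
have := fnd_foldr_set uxs szE; set f := foldr _ _ _ => /= E.
have {}E : map_tuple (fun x => f.[? x]%fmap) xs = map_tuple Some ys.
  exact: val_inj.
by have := congr1 (fun u => tnth u i) E; rewrite !tnth_map.
Qed.

Lemma fnd_foldr_map (K : choiceType) (V T : Type) (fa : K -> T) (fb : V -> T)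
    (xs : seq K) (ys : seq V) x y :
    map fa xs = map fb ys ->
  ((fmap_of xs ys).[? x])%fmap = Some y ->
  fa x = fb y.
Proof.
elim: xs ys => [|x' xs IH] [|y' ys] //= => [_|[E Es]]; first by rewrite fnd_fmap0.
by rewrite fnd_set; case: eqP => [-> [<-] //|_]; apply: IH.
Qed.

Lemma Forall_tnth (T : Type) (P : T -> Prop) n (ts : n.-tuple T) :
  List.Forall P ts -> forall i, P (tnth ts i).
Proof.
elim: n ts => [|n IH] ts Pts i; first by case: i.
case/tupleP: ts Pts => t ts /List.Forall_cons_iff[Pt Pts].
by case: (unliftP ord0 i) => [j ->|->]; rewrite ?tnth0 // tnthS; apply: IH.
Qed.

(** Turns left-linearity into disjointness of the variables of distinct arguments. *)
Lemma uniq_flatten_tnth (T : eqType) n (ss : n.-tuple (seq T)) i j x :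
    uniq (flatten ss) -> i != j -> x \in tnth ss i -> x \notin tnth ss j.
Proof.
elim: n ss i j => [|n IH] ss i j; first by case: i.
case/tupleP: ss => s ss /=; rewrite cat_uniq => /and3P[_ /hasPn dis uss].
have {}dis k y : y \in tnth ss k -> y \notin s.
  by move=> yk; apply: dis; apply/flattenP; exists (tnth ss k); rewrite ?mem_tnth.
case: (unliftP ord0 i) => [i' ->|->]; case: (unliftP ord0 j) => [j' ->|->] //;
  rewrite ?tnth0 ?tnthS.
- by rewrite (inj_eq (@lift_inj _ _)) => ij; apply: IH.
- by move=> _ /dis.
- by move=> _ xs; apply/negP => /dis; rewrite xs.
Qed.

Lemma uniq_flatten_uniq_tnth (T : eqType) n (ss : n.-tuple (seq T)) :
  uniq (flatten ss) -> forall i, uniq (tnth ss i).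
Proof.
elim: n ss => [|n IH] ss uss i; first by case: i.
case/tupleP: ss uss => s ss /=; rewrite cat_uniq => /and3P[us _ uss].
by case: (unliftP ord0 i) => [j ->|->]; rewrite ?tnth0 // tnthS; apply: IH.
Qed.

Lemma vars_FunP (Sg : signature) n (ts : n.-tuple (term Sg)) f x :
  x \in vars (Fun f ts) -> exists i, x \in vars (tnth ts i).
Proof.
rewrite /= => /flattenP[s]; rewrite -[map _ _]/(tval (map_tuple (@vars Sg) ts)).
by case/tnthP=> i -> xi; exists i; rewrite tnth_map in xi.
Qed.

Lemma fresh_vars (Sg : signature) (ss : seq (srt Sg)) (avoid : seq (var Sg)) :
  exists xs : seq (var Sg),
    [/\ uniq xs, map (@var_sort Sg) xs = ss
      & forall x, x \in xs -> x \notin avoid].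
Proof.
elim: ss => [|s ss [xs [uxs sxs fr]]]; first by exists [::].
have [x [sx]] := var_inf s (xs ++ avoid); rewrite mem_cat negb_or => /andP[xxs xa].
exists (x :: xs); split=> /=; rewrite ?xxs ?sx ?sxs // => y.
by rewrite inE => /predU1P[->|/fr].
Qed.

(** * Invariants of typing, weakening, and contexts for patterns *)

Section Typing.
Variables (Sg : signature) (F : sym Sg -> set (decl Sg)).
Hypothesis asigF : is_annotated_signature F.
Implicit Types (t v : term Sg) (A B C : atype Sg) (Gamma Delta : ctx Sg)
  (h : var Sg -> term Sg).

Definition ctx_sorted Gamma :=
  forall x A, (Gamma.[? x])%fmap = Some A -> var_sort x = A.1.

(** Contexts are raw finite maps; it is derivability that makes them respect the sorts of variables
    and cover the variables of the term. *)
Lemma typing_sound Gamma p t C :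
    typing F Gamma p t C ->
  [/\ wf t, term_sort t = C.1, {subset vars t <= domf Gamma}
    & ctx_sorted Gamma].
Proof.
elim=> {Gamma p t C}.
- move=> f xs As p C Ff uxs sE; have [/= aE rE] := asig_base asigF Ff.
  have szE : size xs = size As by rewrite -(size_map (@var_sort Sg)) sE size_map.
  split=> [|//| x|x A].
  + rewrite -map_comp /= (eq_map (g := @var_sort Sg)) // sE.
    by rewrite -[X in X == _]/(map fst As) aE eqxx andbT all_map; apply/allP.
  + rewrite mem_foldr_set // => /flattenP[s]; rewrite -map_comp => /mapP[y yxs ->].
    by rewrite inE => /eqP->.
  + exact: fnd_foldr_map.
- by [].
- move=> n f xs As p0 Gammas ps ts C uxs fr _ [/andP[_ /eqP sxs] srtC _ ctxs] _ IH dis.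
  split=> //.
  + apply/andP; split; first by apply/all_tnthP => i; have [] := IH i.
    rewrite -sxs -map_comp; apply/eqP.
    rewrite -[LHS]/(tval (map_tuple (@term_sort Sg) ts)).
    rewrite -[RHS]/(tval (map_tuple (@term_sort Sg \o Var) xs)).
    congr tval; apply: eq_from_tnth => i; rewrite !tnth_map /=.
    have [_ -> _ _] := IH i.
    by rewrite -(ctxs _ _ (fnd_foldr_tnth As i uxs)).
  + move=> x /vars_FunP[i xi]; have [_ _ sub _] := IH i.
    by rewrite mem_big_catf; apply/existsP; exists i; apply: sub.
  + move=> x A E.
    have : x \in domf (\big[@catf _ _/[fmap]%fmap]_(i < n) tnth Gammas i).
      by rewrite -fndSome E.
    rewrite mem_big_catf => /existsP[i xi]; have [_ _ _ cs] := IH i.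
    by apply: cs; rewrite -E (fnd_big_catf _ xi).
- move=> Gamma x A p t C _ [wt st sub cs] xG sx; split=> // [y /sub yG|y B].
    by rewrite !inE yG orbT.
  by rewrite fnd_set; case: eqP => [-> [<-] //|_]; apply: cs.
- move=> Gamma x y z A A1 A2 p t C _ [wt st sub cs] [s1 s2 _] /= uq xG yG zG sz.
  have xy : x != y by move: uq; rewrite !inE !negb_or => /andP[/andP[]].
  set g := fun w => _.
  (* Merging [x] and [y] into [z] preserves sorts because sharing keeps the base type. *)
  have gs w : w \in vars t -> var_sort (g w) = var_sort w.
    move=> wt'; rewrite /g !inE; case: eqP => [->|_] /=.
      by rewrite sz s1 -(cs x A1) // fnd_set (negPf xy) fnd_set eqxx.
    by case: eqP => [->|//]; rewrite sz s2 -(cs y A2) // fnd_set eqxx.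
  have [|wE sE] := @tmap_sort _ (fun w => Var (g w)) t.
    by move=> w /gs.
  rewrite -/(rename g t) in wE sE; rewrite wE sE; split=> // w.
    rewrite vars_rename => /mapP[u /sub]; rewrite !inE => uG ->.
    rewrite /g !inE; case: (boolP ((u == x) || _)) => [_|]; first by rewrite eqxx.
    rewrite negb_or => /andP[/negPf ux /negPf uy].
    by move: uG; rewrite ux uy /= => ->; rewrite orbT.
  move=> B; rewrite fnd_set; case: eqP => [-> [<-] //|_] wB; apply: cs.
  have wG : w \in domf Gamma by rewrite -fndSome wB.
  rewrite !fnd_set; case: eqP => [wy|_]; first by rewrite -wy wG in yG.
  by case: eqP => [wx|_ //]; rewrite -wx wG in xG.
- move=> Gamma x A B p t C _ [wt st sub cs] xG [sAB _]; split=> // y D.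
  rewrite fnd_set; case: eqP => [-> [<-]|nyx yD].
    by rewrite sAB; apply: cs; rewrite fnd_set eqxx.
  by apply: cs; rewrite fnd_set; case: eqP.
- move=> x A sx; split=> // [y|y B]; first by rewrite !inE => ->.
  by rewrite fnd_set; case: eqP => [-> [<-] //|]; rewrite fnd_fmap0.
- by move=> Gamma p t C D _ [wt st sub cs] [sE _]; split=> //; rewrite st.
Qed.

(** Induction on the number of variables of [Delta] missing from [Gamma], each added by [ty_weak];
    when none is missing the two contexts are equal. *)
Lemma typing_weaken Gamma Delta p t C :
    typing F Gamma p t C ->
    (forall x A, Gamma.[? x]%fmap = Some A -> Delta.[? x]%fmap = Some A) ->
    ctx_sorted Delta ->
  typing F Delta p t C.
Proof.
move=> + + cD; move n_def: #|` domf Delta `\` domf Gamma|%fset => n.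
elim: n Gamma n_def => [|n IH] Gamma n_def tyt sub.
  have <- // : Gamma = Delta; apply/fmapP => x.
  case xG: (Gamma.[? x])%fmap => [A|]; first by rewrite (sub _ _ xG).
  apply/esym/eqP/negPn; rewrite -[_ == None]negbK; apply/negP => /negPn xD.
  have : x \in (domf Delta `\` domf Gamma)%fset.
    rewrite inE -!fndSome xG /=; by case: (_.[? _])%fmap xD.
  by rewrite (cardfs0_eq n_def).
have /fset0Pn[x] : (domf Delta `\` domf Gamma)%fset != fset0.
  by rewrite -cardfs_gt0 n_def.
rewrite inE => /andP[xG]; rewrite -fndSome.
case xA: (Delta.[? x])%fmap => [A|] // _.
apply: (IH Gamma.[x <- A]%fmap) => [| |y B].
- have -> : (domf Delta `\` domf Gamma.[x <- A]%fmap)%fset =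
            ((domf Delta `\` domf Gamma) `\ x)%fset.
    by apply/fsetP => y; rewrite !inE negb_or -andbA.
  have := cardfsD1 x (domf Delta `\` domf Gamma)%fset.
  by rewrite n_def !inE xG -fndSome xA /= add1n => -[<-].
- by apply: ty_weak => //; apply: cD.
- by rewrite fnd_set; case: eqP => [-> [<-] //|_]; apply: sub.
Qed.

Definition ctx_pot h Gamma : rat :=
  fmap_sum (fun x A => potential F (h x) A) Gamma.

Lemma ctx_pot_ctx_of h xs As :
    uniq xs -> size xs = size As ->
  ctx_pot h (ctx_of xs As) = potentials F (map h xs) As.
Proof.
move=> uxs szE; rewrite /ctx_pot fmap_sum_foldr //.
elim: xs As szE {uxs} => [|x xs IH] [|A As] //=; first by rewrite big_nil.
by case=> szE; rewrite big_cons IH.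
Qed.

(** An exact splitting of the potential of the instances of [l] into a part carried by its variables
    and a constant [k]. [Gamma] and [k] are fixed before [h], so one splitting serves all
    instances. *)
Definition pattern_ctx l A Gamma k :=
  [/\ domf Gamma =i vars l, typing F Gamma k l A
    & forall h, ctx_pot h Gamma + k = potential F (tmap h l) A].

(** Linearity makes the contexts of distinct patterns disjoint, so that the potential of their union
    is the sum of their potentials. *)
Lemma pattern_ctxs n (ls : n.-tuple (term Sg)) (As : n.-tuple (atype Sg)) :
    (forall i, exists Gamma k, pattern_ctx (tnth ls i) (tnth As i) Gamma k) ->
    uniq (flatten (map (@vars Sg) ls)) ->
  exists (Gs : n.-tuple (ctx Sg)) (ks : n.-tuple rat),
    (forall i, pattern_ctx (tnth ls i) (tnth As i) (tnth Gs i) (tnth ks i)) /\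
    pairwise_disjoint (tnth Gs).
Proof.
move=> H uq.
have {}H i : exists Gk : ctx Sg * rat,
    pattern_ctx (tnth ls i) (tnth As i) Gk.1 Gk.2.
  by have [G [k ?]] := H i; exists (G, k).
have [Gk HGk] := choice H.
exists (mktuple (fun i => (Gk i).1)), (mktuple (fun i => (Gk i).2)).
split=> [i|i j ij]; first by rewrite !tnth_mktuple.
rewrite !tnth_mktuple; apply/fdisjointP => x.
have [-> _ _] := HGk i; have [-> _ _] := HGk j.
rewrite -!(tnth_map (@vars Sg)); exact: uniq_flatten_tnth.
Qed.

Lemma ctx_pot_pattern_ctxs n (ls : n.-tuple (term Sg)) (As : n.-tuple (atype Sg))
    (Gs : n.-tuple (ctx Sg)) (ks : n.-tuple rat) h :
    (forall i, pattern_ctx (tnth ls i) (tnth As i) (tnth Gs i) (tnth ks i)) ->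
    pairwise_disjoint (tnth Gs) ->
  ctx_pot h (\big[@catf _ _/[fmap]%fmap]_(i < n) tnth Gs i) +
    \sum_(i < n) tnth ks i = potentials F (map (tmap h) ls) As.
Proof.
move=> HG dG; rewrite /ctx_pot fmap_sum_big_catf // -big_split /=.
rewrite -[map _ _]/(tval (map_tuple (tmap h) ls)) potentialsE.
by apply: eq_bigr => i _; rewrite tnth_map; have [_ _ <-] := HG i.
Qed.

Lemma mem_pattern_ctxs n (ls : n.-tuple (term Sg)) (As : n.-tuple (atype Sg))
    (Gs : n.-tuple (ctx Sg)) (ks : n.-tuple rat) f :
    (forall i, pattern_ctx (tnth ls i) (tnth As i) (tnth Gs i) (tnth ks i)) ->
  domf (\big[@catf _ _/[fmap]%fmap]_(i < n) tnth Gs i) =i vars (Fun f ls).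
Proof.
move=> HG x; rewrite mem_big_catf; apply/existsP/idP => [[i]|/vars_FunP[i xi]].
  by have [-> _ _] := HG i; apply: mem_vars_tnth.
by exists i; have [-> _ _] := HG i.
Qed.

(** Induction on the pattern. A variable takes the whole type [A] at cost 0; a constructor
    distributes [A] by its unique declaration with result [A], whose cost is added to those of the
    arguments. *)
Lemma pattern_typing l A :
    no_defined l -> wf l -> uniq (vars l) -> A.1 = term_sort l ->
  exists Gamma k, pattern_ctx l A Gamma k.
Proof.
elim/term_ind_Forall: l A => [x|f ts IH] A.
  move=> _ _ _ sA; exists [fmap].[x <- A]%fmap, 0; split.
  - by move=> y; rewrite !inE orbF.
  - exact: ty_var.
  - by move=> h; rewrite /ctx_pot fmap_sum_set // fmap_sum0 !addr0.
case: f => // c nts /= /andP[wts /eqP sts] uts sA.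
have [Fd rd] := decl_with_resP asigF sA.
have sAs := decl_with_res_sorts asigF sA.
have dE : decl_with_res F (inl c) A = (decl_args (decl_with_res F (inl c) A),
  decl_cost (decl_with_res F (inl c) A), A).
  by case: (decl_with_res _ _ _) rd => [[? ?] ?] /= <-.
move: (decl_args _) (decl_cost _) sAs dE => Aseq p sAs dE.
have [n [ls [As [lsE AsE]]]] : exists n (ls : n.-tuple (term Sg))
    (As : n.-tuple (atype Sg)), tval ls = ts /\ tval As = Aseq.
  have szE : size Aseq == size ts.
    by rewrite -(size_map fst) sAs -sts size_map.
  by exists (size ts), (in_tuple ts), (Tuple szE).
subst ts Aseq; rewrite dE in Fd.
have sE i : (tnth As i).1 = term_sort (tnth ls i).
  have E : map_tuple fst As = map_tuple (@term_sort Sg) ls.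
    by apply: val_inj; rewrite /= sts.
  by have := congr1 (fun u => tnth u i) E; rewrite !tnth_map.
have [|//|Gs [ks [HG dG]]] := @pattern_ctxs n ls As.
  move=> i; apply: (Forall_tnth IH) => //.
  - by move/all_tnthP: nts.
  - by move/all_tnthP: wts.
  - have /= := uniq_flatten_uniq_tnth uts.
    by move/(_ i); rewrite tnth_map.
(* The composition rule types [c] on variables that are fresh for the pattern and for all argument
   contexts. *)
have [xs [uxs sxs fr]] := fresh_vars (arg_sorts (inl c))
  (vars (Fun (inl c) ls) ++
    domf (\big[@catf _ _/[fmap]%fmap]_(i < n) tnth Gs i)).
have szx : size xs == n.
  by rewrite -(size_map (@var_sort Sg)) sxs -sAs size_map size_tuple.
exists (\big[@catf _ _/[fmap]%fmap]_(i < n) tnth Gs i),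
  (p%:num + \sum_(i < n) tnth ks i); split.
- exact: mem_pattern_ctxs HG.
- apply: (@ty_comp _ F n _ (Tuple szx) As) => //.
  + move=> x /fr; rewrite mem_cat negb_or => /andP[xv xG]; split=> // i.
    by apply: contra xG => xi; rewrite mem_big_catf; apply/existsP; exists i.
  + by apply: ty_decl; rewrite //= sxs.
  + by move=> i; have [] := HG i.
- move=> h; rewrite addrCA (ctx_pot_pattern_ctxs h HG dG).
  by rewrite [tmap _ _]/= potential_Fun dE.
Qed.

End Typing.

(** * The cost bound for environment-free evaluation *)

Section Soundness.
Variables (Sg : signature) (R : set (rule Sg)) (F : sym Sg -> set (decl Sg)).
Hypotheses (trsR : is_trs R) (asigF : is_annotated_signature F).
Hypothesis wtR : well_typed_trs F R.
Implicit Types (t v : term Sg) (A B C : atype Sg) (Gamma : ctx Sg)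
  (h : var Sg -> term Sg).

Definition well_typed_inst h Gamma :=
  forall x A, (Gamma.[? x])%fmap = Some A -> value_of_sort (h x) A.1.

Lemma typing_inst Gamma p t C h :
    typing F Gamma p t C -> well_typed_inst h Gamma ->
  wf (tmap h t) /\ term_sort (tmap h t) = C.1.
Proof.
move=> tyt wth; have [wt st sub cs] := typing_sound asigF tyt.
have [|-> ->] := @tmap_sort _ h t; last by rewrite wt st.
move=> x /sub; rewrite -fndSome; case xA: (Gamma.[? x])%fmap => [A|] // _.
by have [[] ] := wth _ _ xA; rewrite (cs _ _ xA).
Qed.

Lemma typing_geval_sort Gamma p t C h m v :
    typing F Gamma p t C -> well_typed_inst h Gamma ->
    geval R (tmap h t) m v ->
  value_of_sort v C.1.
Proof.
move=> tyt wth; have [wt <-] := typing_inst tyt wth => ev.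
by have [H _] := geval_sound trsR; apply: H ev wt.
Qed.

Lemma well_typed_inst_ctx_of h xs As :
    List.Forall (@value Sg) (map h xs) ->
    map (@term_sort Sg) (map h xs) = map fst As ->
  well_typed_inst h (ctx_of xs As).
Proof.
elim: xs As => [|x xs IH] [|A As] //=.
  by move=> _ _ x A; rewrite fnd_fmap0.
move=> /List.Forall_cons_iff[vx vxs] [sx sxs] y B; rewrite fnd_set.
by case: eqP => [-> [<-] //|_]; apply: IH.
Qed.

(** Here a unit of cost is paid. The potential of [vs] splits into that of [tau] on the pattern
    context and the pattern costs [ks], and well-typedness types the right-hand side at [p - 1] plus
    the sum of [ks]. The last hypothesis is the outer induction hypothesis, for strictly smaller
    costs. *)
Lemma gapply_rule_potential f vs (As : seq (atype Sg)) (p : {nonneg rat}) C m v :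
    F (inr f) (As, p, C) -> gapply R (inr f) vs m v ->
    (forall Gamma q t A h k w, typing F Gamma q t A -> well_typed_inst h Gamma ->
       (k < m)%N -> geval R (tmap h t) k w ->
       k%:R + potential F w A <= ctx_pot F h Gamma + q) ->
  m%:R + potential F v C <= potentials F vs As + p%:num.
Proof.
move=> Ff /gapply_dfnP[[f' args r] [tau [k [Rrho /= ? -> -> [wtau ev]]]]] IH.
subst f'.
have [[/= /andP[wargs /eqP sargs] wr] nargs _ _] := trs_rule_wf trsR Rrho.
have uargs := trs_left_linear trsR Rrho.
have [/= sAs _] := asig_base asigF Ff.
have [n [ls [As' [lsE AsE]]]] : exists n (ls : n.-tuple (term Sg))
    (As' : n.-tuple (atype Sg)), tval ls = args /\ tval As' = As.
  have szE : size As == size args.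
    by rewrite -(size_map fst) sAs -sargs size_map.
  by exists (size args), (in_tuple args), (Tuple szE).
subst args As; rename As' into As.
have sE i : (tnth As i).1 = term_sort (tnth ls i).
  have E : map_tuple fst As = map_tuple (@term_sort Sg) ls.
    by apply: val_inj; rewrite /= sargs.
  by have := congr1 (fun u => tnth u i) E; rewrite !tnth_map.
have [|//|Gs [ks [HG dG]]] := @pattern_ctxs _ F n ls As.
  move=> i; apply: pattern_typing => //.
  - by move/all_tnthP: nargs.
  - by move/all_tnthP: wargs.
  - have /= := uniq_flatten_uniq_tnth (uargs : uniq (flatten (map_tuple _ ls))).
    by move/(_ i); rewrite tnth_map.
set Gamma := \big[@catf _ _/[fmap]%fmap]_(i < n) tnth Gs i.
have domG : domf Gamma =i vars (Fun (inr f) ls) := mem_pattern_ctxs (inr f) HG.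
have fndG i x A : ((tnth Gs i).[? x])%fmap = Some A -> (Gamma.[? x])%fmap = Some A.
  by move=> xA; rewrite (fnd_big_catf (i := i)) // -fndSome xA.
have csG : ctx_sorted Gamma.
  move=> x A xA; have : x \in domf Gamma by rewrite -fndSome xA.
  rewrite mem_big_catf => /existsP[i xi]; have [_ tyi _] := HG i.
  have [_ _ _ cs] := typing_sound asigF tyi.
  by apply: cs; rewrite -xA -(fnd_big_catf dG xi).
(* Well-typedness asks for all patterns to be typed in one common context, so each typing is
   weakened to the union [Gamma]. *)
have tyr : typing F Gamma (p%:num - 1 + \sum_(i < n) tnth ks i) r C.
  apply: (wtR Rrho Ff domG) => i.
  by have [_ tyi _] := HG i; apply: typing_weaken tyi _ csG => x A; apply: fndG.
have wttau : well_typed_inst tau Gamma.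
  move=> x A xA; rewrite -(csG _ _ xA).
  have : x \in domf Gamma by rewrite -fndSome xA.
  by rewrite domG; apply: wtau.
have := IH _ _ _ _ _ _ _ tyr wttau (ltnSn k) ev.
(* The sum of [ks] now occurs on both sides, and the [- 1] in the cost of [r] accounts for the
   successor in [k.+1]. *)
rewrite -(ctx_pot_pattern_ctxs tau HG dG) -/Gamma -natr1.
lra.
Qed.

(** The bound [m <= N], instead of an equality, lets the inner induction pass to subterms that
    account for only part of the cost; [N] decreases only when a rule is applied. The quantifiers
    over [h] and [m] follow the derivation because composition and sharing change the instance. *)
Lemma typing_potential N Gamma p t A :
    typing F Gamma p t A ->
  forall h m v, well_typed_inst h Gamma -> (m <= N)%N ->
    geval R (tmap h t) m v ->
  m%:R + potential F v A <= ctx_pot F h Gamma + p.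
Proof.
elim/ltn_ind: N Gamma p t A => N IHN Gamma p t A.
elim=> {Gamma p t A}.
- move=> f xs As p C Ff uxs sE h m v wth mN.
  have szE : size xs = size As by rewrite -(size_map (@var_sort Sg)) sE size_map.
  have vxs : List.Forall (@value Sg) (map h xs).
    apply: Forall_map_in => x xxs; have : x \in domf (ctx_of xs As).
      by rewrite mem_foldr_set.
    rewrite -fndSome; case xA: (_.[? _])%fmap => [A|] // _.
    by have [] := wth _ _ xA.
  rewrite [tmap _ _]/= -map_comp -[map _ xs]/(map h xs).
  move/(geval_Fun_values _ _ _ _ vxs)=> Ev; rewrite ctx_pot_ctx_of //.
  case: f Ff Ev => [c|f] Ff Ev.
    have [-> ->] := gapply_conP Ev.
    have := decl_with_res_eq asigF Ff; rewrite /decl_res /= add0r => dE.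
    by rewrite -/(potential F (Fun (inl c) (map h xs)) C) potential_Fun dE addrC.
  (* The typing of the right-hand side is not a subderivation of the current one, so the outer
     induction on the cost is used. *)
  apply: gapply_rule_potential Ff Ev _ => Gamma q t A h' k w tyt wth' km.
  have kN : (k < N)%N := leq_trans km mN.
  exact: (IHN k kN _ _ _ _ tyt h' k w wth' (leqnn k)).
- move=> Gamma p p' t C _ IH le h m v wth mN ev.
  by apply: le_trans (IH h m v wth mN ev) _; rewrite lerD2l.
- move=> n f xs As p0 Gammas ps ts C uxs _ tyf IHf tyts IHts dis h m v wth mN.
  have wti i : well_typed_inst h (tnth Gammas i).
    move=> x A xA; apply: wth; rewrite (fnd_big_catf (i := i)) //.
    by rewrite -fndSome xA.
  case/geval_FunP=> us [m0 [m1 [mE Es Ef]]].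
  have {Es}[vs [ms [vsE m1E Es]]] := gevals_tupleP (ts := map_tuple _ ts) Es.
  subst us.
  have {}Es i : geval R (tmap h (tnth ts i)) (tnth ms i) (tnth vs i).
    by have := Es i; rewrite tnth_map.
  have m1N : (m1 <= N)%N by apply: leq_trans mN; rewrite mE leq_addl.
  have m0N : (m0 <= N)%N by apply: leq_trans mN; rewrite mE leq_addr.
  have msN i : (tnth ms i <= N)%N.
    by apply: leq_trans m1N; rewrite m1E (bigD1 i) //= leq_addr.
  have vvs i : value_of_sort (tnth vs i) (tnth As i).1.
    exact: typing_geval_sort (tyts i) (wti i) (Es i).
  (* [h'] sends the fresh variables [xs] to the argument values; elsewhere the index is out of range
     and the default [h x] is returned. *)
  pose h' x := nth (h x) vs (index x xs).
  have h'i i : h' (tnth xs i) = tnth vs i.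
    rewrite /h' {2}(tnth_nth (tnth xs i)) index_uniq ?size_tuple //.
    by rewrite -tnth_nth.
  have h'E : map h' xs = vs.
    rewrite -[LHS]/(tval (map_tuple h' xs)); congr tval.
    by apply: eq_from_tnth => i; rewrite tnth_map.
  have Fvs : List.Forall (@value Sg) vs.
    rewrite -h'E; apply: Forall_map_in => x /tnthP[i ->].
    by rewrite h'i; have [] := vvs i.
  have wth' : well_typed_inst h' (ctx_of xs As).
    apply: well_typed_inst_ctx_of; rewrite h'E //.
    rewrite -[LHS]/(tval (map_tuple _ vs)) -[RHS]/(tval (map_tuple _ As)).
    congr tval; apply: eq_from_tnth => i; rewrite !tnth_map.
    by have [] := vvs i.
  have {}IHf : m0%:R + potential F v C <= ctx_pot F h' (ctx_of xs As) + p0.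
    apply: IHf wth' m0N _ => /=; rewrite -map_comp -[map _ xs]/(map h' xs) h'E.
    exact/geval_Fun_values.
  have {}IHts : m1%:R + potentials F vs As <=
      ctx_pot F h (\big[@catf _ _/[fmap]%fmap]_(i < n) tnth Gammas i) +
      \sum_(i < n) tnth ps i.
    rewrite m1E potentialsE natr_sum /ctx_pot fmap_sum_big_catf // -!big_split.
    by apply: ler_sum => i _; apply: IHts.
  (* The potential of [vs] is what the arguments leave over and what the application starts from, so
     it cancels when the two bounds are added. *)
  move: IHf; rewrite ctx_pot_ctx_of ?size_tuple // h'E mE natrD.
  by move: IHts; lra.
- move=> Gamma x A p t C _ IH xG sx h m v wth mN ev.
  have {}IH : m%:R + potential F v C <= ctx_pot F h Gamma + p.
    apply: IH mN ev => y B yB; apply: wth; rewrite fnd_set; case: eqP => // yx.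
    by move: xG; rewrite -fndSome -yx yB.
  rewrite /ctx_pot fmap_sum_set // -addrA; apply: le_trans IH _.
  by rewrite lerDr potential_ge0.
- move=> Gamma x y z A A1 A2 p t C _ IH sh uq xG yG zG sz h m v wth mN.
  have /and3P[] : [&& x != y, z != x & z != y].
    by move: uq; rewrite /= !inE !negb_or => /and3P[/andP[-> zx] zy _];
       rewrite eq_sym zx eq_sym zy.
  move=> xy zx zy.
  (* The instance of [t[z,z]] by [h] is the instance of [t[x,y]] by [h'], which sends both [x] and
     [y] to [h z]; the evaluation itself is unchanged. *)
  rewrite /rename tmap_comp [fun w => _]/=; set h' := fun w => _ => ev.
  have h'x : h' x = h z by rewrite /h' mem_head.
  have h'y : h' y = h z by rewrite /h' !inE eqxx orbT.
  have h'G w B : (Gamma.[? w])%fmap = Some B -> h' w = h w /\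
      (Gamma.[z <- A].[? w])%fmap = Some B.
    move=> wB; have wG : w \in domf Gamma by rewrite -fndSome wB.
    rewrite /h' !inE fnd_set.
    case: eqP => [wx|_]; first by rewrite -wx wG in xG.
    case: eqP => [wy|_]; first by rewrite -wy wG in yG.
    by case: eqP => [wz|_ //]; rewrite -wz wG in zG.
  have [vz sz'] : value_of_sort (h z) A.1 by apply: wth; rewrite fnd_set eqxx.
  have := IH h' m v _ mN ev.
  have yG' : y \notin domf Gamma.[x <- A1]%fmap.
    by rewrite !inE negb_or eq_sym xy.
  rewrite /ctx_pot !fmap_sum_set // h'x h'y (potential_share asigF vz _ sh) //.
  rewrite (@eq_fmap_sum _ _ _ (fun x A => potential F (h x) A) Gamma); last first.
    by move=> w B /h'G[->].
  move=> E; apply: le_trans (E _) _; last by lra.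
  case: sh => s1 s2 _ w B; rewrite !fnd_set.
  case: eqP => [-> [<-]|_]; first by rewrite h'y -s2.
  case: eqP => [-> [<-]|_]; first by rewrite h'x -s1.
  by case/h'G=> -> /wth.
- move=> Gamma x A B p t C _ IH xG sAB h m v wth mN ev.
  have [vx sx] : value_of_sort (h x) A.1 by apply: wth; rewrite fnd_set eqxx.
  have := IH h m v _ mN ev; rewrite /ctx_pot !fmap_sum_set // => E.
  apply: le_trans (E _) _; last by rewrite !lerD2r (potential_le asigF).
  move=> y D; rewrite fnd_set; case: eqP => [-> [<-]|yx yD].
    by case: sAB => <- _; split.
  by apply: wth; rewrite fnd_set; case: eqP.
- move=> x A sx h m v wth mN ev.
  have [vx _] : value_of_sort (h x) A.1 by apply: wth; rewrite fnd_set eqxx.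
  have [-> ->] := geval_value vx ev.
  by rewrite /ctx_pot fmap_sum_set // fmap_sum0 !addr0 add0r.
- move=> Gamma p t C D tyt IH sDC h m v wth mN ev.
  have [vv sv] := typing_geval_sort tyt wth ev.
  apply: le_trans (IH h m v wth mN ev); rewrite lerD2l.
  by apply: (potential_le asigF).
Qed.

End Soundness.

(** * Transfer of the bound to evaluation under a substitution *)

Theorem theorem1 (Sg : signature) (R : set (rule Sg))
    (F : sym Sg -> set (decl Sg))
    (trsR : is_trs R) (asigF : is_annotated_signature F)
    (wtR : well_typed_trs F R)
    (Gamma : ctx Sg) (t : term Sg) (A : atype Sg) (p : rat)
    (tyt : typing F Gamma p t A)
    (sigma : subst Sg) (nsigma : normalised sigma)
    (wtsigma : well_typed_subst sigma Gamma)
    (m : nat) (v : term Sg) (valv : value v)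
    (ev : eval R sigma t m v) :
  ctx_potential F sigma Gamma - potential F v A + p >= m%:R.
Proof.
pose h x := app sigma (Var x).
have wth : well_typed_inst h Gamma.
  move=> x B xB; have xG : x \in domf Gamma by rewrite -fndSome xB.
  have [vx sx] := wtsigma [` xG]%fset; split=> //; rewrite -[LHS]/(_) sx.
  by congr (_.1); apply: Some_inj; rewrite -xB (Some_fnd [` xG]%fset).
have [_ _ sub _] := typing_sound asigF tyt.
have {}ev : geval R (tmap h t) m v.
  (* The variables of [t] lie in the domain of [Gamma], where [sigma] yields values. *)
  apply: (eval_geval trsR ev) => x /sub xG.
  by have [] := wtsigma [` xG]%fset.
have := typing_potential trsR asigF wtR tyt wth (leqnn m) ev.
rewrite /ctx_pot fmap_sumE -/(ctx_potential F sigma Gamma); lra.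
Qed.
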